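(* Let $(x_{0:K}, y_{1:K})$ follow the linear Gaussian state-space model described in the context. Consider the following procedure. 1. Initialise $q_0(\cdot \mid x_0) = \mathcal{N}(G_{0\mid 0}x_0 + p_{0\mid 0}, P_{0\mid 0})$ with $G_{0\mid 0} = I_D$, $p_{0\mid 0}=0$, $P_{0\mid 0}=0$ (that is, $q_0(\cdot\mid x_0)$ is the point mass at $x_0$). 2. For $k=1,\dots,K$, define $q_k$ from $q_{k-1}$ by $$q_k(\cdot \mid x_k, y_{1:k-1}) = \int q_{k-1}(\cdot \mid x_{k-1}, y_{1:k-2})\, p(x_{k-1}\mid x_k, y_{1:k-1})\,\mathrm{d}x_{k-1},$$ where $p(x_{k-1}\mid x_k, y_{1:k-1})$ is the conditional distribution of $x_{k-1}$ given $(x_k, y_{1:k-1})$. 3. Form $$q(\cdot\mid y_{1:K}) = \int q_K(\cdot\mid x_K, y_{1:K-1})\, p(x_K\mid y_{1:K})\,\mathrm{d}x_K,$$ where $p(x_K\mid y_{1:K})$ is the conditional distribution of $x_K$ given $y_{1:K}$ (the output of the Kalman filter). Then for every $k=1,\dots,K$, $q_k(\cdot\mid x_k,y_{1:k-1})$ is the conditional distribution $p(x_0\mid x_k, y_{1:k-1})$ of $x_0$ given $(x_k, y_{1:k-1})$, and $q(\cdot\mid y_{1:K})$ is the solution of the fixed-point smoothing problem, i.e. the conditional distribution $p(x_0\mid y_{1:K})$ of $x_0$ given $y_{1:K}$.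
   Context: State-space model. Let $d, D, K\ge 1$ be integers, $A_1,\dots,A_K\in\mathbb{R}^{D\times D}$, $H_1,\dots,H_K\in\mathbb{R}^{d\times D}$, $m_{0\mid 0}\in\mathbb{R}^D$, and let $C_{0\mid 0},B_1,\dots,B_K\in\mathbb{R}^{D\times D}$ and $R_1,\dots,R_K\in\mathbb{R}^{d\times d}$ be covariance matrices (symmetric positive semidefinite, possibly singular). The random variables are $$x_0=\theta,\qquad x_k = A_kx_{k-1}+b_k,\qquad y_k = H_kx_k + r_k,\qquad k=1,\dots,K,$$ with mutually independent $\theta\sim\mathcal{N}(m_{0\mid 0},C_{0\mid 0})$, $b_k\sim\mathcal{N}(0,B_k)$, $r_k\sim\mathcal{N}(0,R_k)$, $k=1,\dots,K$. Notation. $x_{0:K}=\{x_0,\dots,x_K\}$, $y_{1:k}=\{y_1,\dots,y_k\}$, with the convention $y_{1:-1}=y_{1:0}=\emptyset$ (no conditioning on observations). $\mathcal{N}(m,C)$ is the Gaussian distribution with mean $m$ and (possibly singular) covariance $C$. The notation $\int q(\cdot\mid u)\,p(u\mid v)\,\mathrm{d}u$ denotes composition of Markov kernels, i.e. integration of $q(\cdot\mid u)$ against the distribution $p(\cdot\mid v)$ of $u$; the distributions need not have densities. Conditional distributions are regular conditional distributions, and equality of conditional distributions is understood almost surely with respect to the law of the conditioning variables. *)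

(* Defs.v *)
From HB Require Import structures.
From mathcomp Require Import all_boot all_order all_algebra.
From mathcomp Require Import all_classical all_reals all_analysis.
From mathcomp Require Import measurable_realfun.

Set Implicit Arguments.
Unset Strict Implicit.
Unset Printing Implicit Defensive.

Import Order.TTheory GRing.Theory Num.Theory.
Import numFieldNormedType.Exports.

Local Open Scope classical_set_scope.
Local Open Scope ring_scope.

(* Matrices carry the product sigma-algebra of their entries, as tuples do in
   the library; on 'cV[R]_n this is the Borel sigma-algebra of R^n. *)
Definition measure_matrix_display : measure_display -> measure_display.
Proof. exact. Qed.

Section measurable_matrix.
Context {d} {T : sigmaRingType d}.
Variables m n : nat.

Definition matrix_measurable : set (set 'M[T]_(m, n)) :=
  <<s \bigcup_(ij in [set: 'I_m * 'I_n])
        preimage_set_system setT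
          (fun M : 'M[T]_(m, n) => M ij.1 ij.2) measurable >>.

Let matrix_set0 : matrix_measurable set0.
Proof. exact: sigma_algebra0. Qed.

Let matrix_setC A : matrix_measurable A -> matrix_measurable (~` A).
Proof. exact: sigma_algebraC. Qed.

Let matrix_bigcup (F : (set 'M[T]_(m, n))^nat) :
  (forall i, matrix_measurable (F i)) -> matrix_measurable (\bigcup_i (F i)).
Proof. exact: sigma_algebra_bigcup. Qed.

HB.instance Definition _ := @isMeasurable.Build (measure_matrix_display d)
  'M[T]_(m, n) matrix_measurable matrix_set0 matrix_setC matrix_bigcup.

End measurable_matrix.

Definition is_covariance (R : realType) (n : nat) (C : 'M[R]_n) : Prop :=
  C^T = C /\ forall u : 'cV[R]_n, 0 <= (u^T *m C *m u) 0 0.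

(* The univariate N(m, v) for v >= 0. [normal_prob] is indexed by the standard
   deviation, and [normal_prob m 0] is not the point mass at m, so the
   degenerate case is treated separately. *)
Definition normal1 (R : realType) (m v : R) : set R -> \bar R :=
  if v == 0 then dirac m else normal_prob m (Num.sqrt v).

(* mu = N(m, C), with C possibly singular (hence without density): every linear
   functional u^T x is univariate normal N(u^T m, u^T C u) under mu. The matrix
   C is meant to satisfy [is_covariance]. *)
Definition is_gaussian (R : realType) (n : nat)
    (mu : {measure set 'cV[R]_n -> \bar R}) (m : 'cV[R]_n) (C : 'M[R]_n) :
    Prop :=
  forall (u : 'cV[R]_n) (A : set R), measurable A ->
    mu [set x | A ((u^T *m x) 0 0)] =
    normal1 ((u^T *m m) 0 0) ((u^T *m C *m u) 0 0) A.

Definition mutually_independent d (T : measurableType d) (R : realType)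
    (P : probability T R) (I : finType) (F : I -> set (set T)) : Prop :=
  forall (J : {set I}) (E : I -> set T),
    (forall i, i \in J -> F i (E i)) ->
    (P (\big[setI/setT]_(i in J) E i) = \prod_(i in J) P (E i))%E.

Definition sigma_of d d' (T : measurableType d) (U : measurableType d')
    (X : T -> U) : set (set T) :=
  preimage_set_system setT X measurable.

(* The family theta, b_1, ..., b_K, r_1, ..., r_K takes values in two different
   spaces, so it is indexed through the sigma-algebras it generates. *)
Definition noise_sigma dT (T : measurableType dT) (R : realType) (d D K : nat)
    (theta : T -> 'cV[R]_D) (b : nat -> T -> 'cV[R]_D)
    (r : nat -> T -> 'cV[R]_d) (i : option ('I_K + 'I_K)) : set (set T) :=
  match i with
  | None => sigma_of theta
  | Some (inl j) => sigma_of (b j.+1)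
  | Some (inr j) => sigma_of (r j.+1)
  end.

(* kappa is (a version of) the regular conditional distribution of X given Y:
   kappa (Y _) A is a conditional probability of {X \in A} given sigma(Y), for
   every measurable A. *)
Definition is_cond_dist dT dU dV (T : measurableType dT)
    (U : measurableType dU) (V : measurableType dV) (R : realType)
    (P : probability T R) (X : T -> U) (Y : T -> V)
    (kappa : R.-pker V ~> U) : Prop :=
  forall (A : set U) (B : set V), measurable A -> measurable B ->
    (P (X @^-1` A `&` Y @^-1` B) = \int[P]_(w in Y @^-1` B) kappa (Y w) A)%E.

(* The kernel x |-> k (f x). *)
Section kpullback.
Context dX dY dZ (X : measurableType dX) (Y : measurableType dY)
  (Z : measurableType dZ) (R : realType).
Variables (f : X -> Y) (mf : measurable_fun [set: X] f) (k : R.-pker Y ~> Z).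

Definition kpullback (_ : measurable_fun [set: X] f) (x : X) :
  {measure set Z -> \bar R} := k (f x).

Let measurable_kpullback U : measurable U ->
  measurable_fun [set: X] (kpullback mf ^~ U).
Proof.
move=> mU; exact: (measurableT_comp (measurable_kernel k _ mU) mf).
Qed.

HB.instance Definition _ :=
  isKernel.Build _ _ _ _ _ (kpullback mf) measurable_kpullback.

Let kpullback_prob x : kpullback mf x [set: Z] = 1%E.
Proof. exact: prob_kernel. Qed.

HB.instance Definition _ :=
  Kernel_isProbability.Build _ _ _ _ _ (kpullback mf) kpullback_prob.

End kpullback.

(* The library's composition [l \; k], as a probability kernel:
   pkcomp l k x A = \int[l x]_u k (x, u) A. *)
Section pkcomp.
Context dX dY dZ (X : measurableType dX) (Y : measurableType dY)
  (Z : measurableType dZ) (R : realType).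
Variables (l : R.-pker X ~> Y) (k : R.-pker (X * Y) ~> Z).

Definition pkcomp : X -> {measure set Z -> \bar R} := (l \; k)%E.

Let measurable_pkcomp U : measurable U ->
  measurable_fun [set: X] (pkcomp ^~ U).
Proof. exact: measurable_fun_mkcomp_sfinite. Qed.

HB.instance Definition _ :=
  isKernel.Build _ _ _ _ _ pkcomp measurable_pkcomp.

Let pkcomp_prob x : pkcomp x [set: Z] = 1%E.
Proof.
rewrite /pkcomp /= /kcomp; under eq_integral do rewrite prob_kernel.
by rewrite integral_cst//= mul1e prob_kernel.
Qed.

HB.instance Definition _ :=
  Kernel_isProbability.Build _ _ _ _ _ pkcomp pkcomp_prob.

End pkcomp.

(* y_{1:n} |-> y_{1:n-1}; on the empty tuple it is the identity, in accordance
   with y_{1:-1} = y_{1:0} = (). *)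
Definition drop_last (T : Type) (n : nat) (t : n.-tuple T) : n.-1.-tuple T :=
  [tuple tnth t (widen_ord (leq_pred n) i) | i < n.-1].

Lemma measurable_drop_last d (T : measurableType d) (n : nat) :
  measurable_fun [set: n.-tuple T] (@drop_last T n).
Proof.
apply/measurable_fun_tnthP => i.
rewrite (_ : _ \o _ = @tnth n T ^~ (widen_ord (leq_pred n) i)).
  exact: measurable_tnth.
by apply/funext => t /=; rewrite tnth_mktuple.
Qed.

(* y_{1:k} *)
Definition obs (T V : Type) (y : nat -> T -> V) (k : nat) (w : T) :
    k.-tuple V :=
  [tuple y i.+1 w | i < k].

Section fixed_point_smoother.
Context (R : realType) (d D : nat).
Local Notation state := 'cV[R]_D.
Local Notation observation := 'cV[R]_d.

Definition step_arg k (zu : (state * k.-tuple observation) * state) :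
  state * k.-1.-tuple observation := (zu.2, drop_last zu.1.2).

Lemma measurable_step_arg k : measurable_fun setT (@step_arg k).
Proof.
apply: measurable_fun_pair => //=.
apply: measurableT_comp; first exact: measurable_drop_last.
exact: measurableT_comp.
Qed.

Definition output_arg k (yu : k.-tuple observation * state) :
  state * k.-1.-tuple observation := (yu.2, drop_last yu.1).

Lemma measurable_output_arg k : measurable_fun setT (@output_arg k).
Proof.
apply: measurable_fun_pair => //=.
by apply: measurableT_comp; first exact: measurable_drop_last.
Qed.

(* [smoother q0 p k] is q_k( . | x_k, y_{1:k-1}). The backward kernel [p k] is
   p(x_{k-1} | x_k, y_{1:k-1}) for k >= 1; [p 0] is not used. *)
Fixpoint smoother (q0 : R.-pker state ~> state)
    (p : forall k, R.-pker (state * k.-1.-tuple observation) ~> state) (k : nat) :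
    R.-pker (state * k.-1.-tuple observation) ~> state :=
  match k with
  | 0 => kpullback q0 measurable_fst
  | k'.+1 => pkcomp (p k'.+1)
               (kpullback (smoother q0 p k') (@measurable_step_arg k'))
  end.

(* q( . | y_{1:K}), from q_K and the filtering kernel p(x_K | y_{1:K}). *)
Definition smoother_output (K : nat)
    (qK : R.-pker (state * K.-1.-tuple observation) ~> state)
    (pf : R.-pker (K.-tuple observation) ~> state) :
    R.-pker (K.-tuple observation) ~> state :=
  pkcomp pf (kpullback qK (@measurable_output_arg K)).

End fixed_point_smoother.

(* Main.v *)
Require Import Defs.
From mathcomp Require Import all_boot all_order all_algebra.
From mathcomp Require Import all_classical all_reals all_analysis.
From mathcomp Require Import measurable_realfun.

Set Implicit Arguments.
Unset Strict Implicit.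
Unset Printing Implicit Defensive.

Import Order.TTheory GRing.Theory Num.Theory.

Local Open Scope classical_set_scope.
Local Open Scope ring_scope.

(* Given (x_k, y_{1:k-1}), the initial state x_0 is independent of the fresh
   noises r_k and b_{k+1}, and (x_{k+1}, y_{1:k}) is a function of x_k,
   y_{1:k-1} and these noises. Hence p(x_0 | x_k, y_{1:k-1}) is also the
   conditional distribution of x_0 given (x_k, x_{k+1}, y_{1:k}), and integrating
   x_k out against p(x_k | x_{k+1}, y_{1:k}) gives p(x_0 | x_{k+1}, y_{1:k}); the
   output step is the same with the fresh noise r_K alone. Gaussianity enters
   only through q_0, where N(x_0, 0) is the point mass at x_0. *)

(** * Integration against conditional distributions *)

(** Measurable rectangles are a generating pi-system that contains the whole space, so the constant
    sequence [setT] serves as the exhausting one. *)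
Lemma finite_measure_prod_unique d1 d2 (T1 : measurableType d1)
    (T2 : measurableType d2) (R : realType)
    (m1 m2 : {measure set (T1 * T2) -> \bar R}) :
  (m1 setT < +oo)%E ->
  (forall A B, measurable A -> measurable B -> m1 (A `*` B) = m2 (A `*` B)) ->
  forall C, measurable C -> m1 C = m2 C.
Proof.
move=> m1oo m12 C mC.
apply: (measure_unique [set A `*` B | A in measurable & B in measurable]
  (fun=> setT)) => //.
- exact: measurable_prod_measurableType.
- move=> _ _ [A mA [B mB <-]] [A' mA' [B' mB' <-]].
  exists (A `&` A'); first exact: measurableI.
  by exists (B `&` B'); [exact: measurableI|rewrite setXI].
- by move=> _; exists setT => //; exists setT => //; rewrite setXTT.
- by rewrite bigcup_const.
- by move=> _ [A mA [B mB <-]]; exact: m12.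
Qed.

Section conditional_distribution.
Context dT dU dV (T : measurableType dT) (U : measurableType dU)
  (V : measurableType dV) (R : realType) (P : probability T R).
Local Open Scope ereal_scope.

(** The definition of [is_cond_dist] is the case where [f] is the indicator of a rectangle. In
    general both sides integrate [f] against finite measures on [V * U] that agree on rectangles. *)
Lemma cond_dist_integral (X : T -> U) (Y : T -> V) (kappa : R.-pker V ~> U)
    (f : V * U -> \bar R) :
  measurable_fun setT X -> measurable_fun setT Y -> is_cond_dist P X Y kappa ->
  (forall z, 0 <= f z) -> measurable_fun setT f ->
  \int[P]_w f (Y w, X w) = \int[P]_w \int[kappa (Y w)]_u f (Y w, u).
Proof.
move=> mX mY XY f0 mf.
have mYX : measurable_fun setT (fun w => (Y w, X w)).
  exact: measurable_fun_pair.
(* [graph v] is the law of [(v, u)] for [u] drawn from [kappa v]. *)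
pose graph : R.-pker V ~> (V * U)%type  :=
  pkcomp kappa (kdirac (@measurable_id _ (V * U)%type setT)).
have mYs : measurable_fun [set: unit * T] (Y \o snd) by exact: measurableT_comp.
(* Viewing [P] as a kernel from [unit] makes the second measure a kernel composition, so that
   [integral_kcomp] yields the iterated integral. *)
pose PT : R.-pker unit ~> T :=
  kprobability (@measurable_cst _ _ unit _ setT (P : pprobability T R)).
pose joint : R.-pker unit ~> (V * U)%type := pkcomp PT (kpullback graph mYs).
transitivity (\int[pushforward P (fun w => (Y w, X w))]_z f z).
  by rewrite ge0_integral_pushforward.
transitivity (\int[joint tt]_z f z).
  apply: eq_measure_integral => C mC _.
  apply: finite_measure_prod_unique => //.
    by rewrite /= /pushforward preimage_setT probability_setT ltry.
  move=> B A mB mA.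
  transitivity (P (X @^-1` A `&` Y @^-1` B)); first by rewrite setIC.
  rewrite XY// integral_mkcond; apply: eq_integral => w _.
  rewrite /= /kpullback /graph /pkcomp /= /kcomp /kdirac.
  rewrite patchE; case: ifPn => wB.
    have YwB : Y w \in B by apply: mem_set; exact: set_mem wB.
    transitivity (\int[kappa (Y w)]_u (\1_A u)%:E).
      by rewrite integral_indic// setIT.
    apply: eq_integral => u _.
    by rewrite [RHS]diracE indicE in_setX/= YwB.
  rewrite integral0_eq// => u _.
  by rewrite [LHS]diracE in_setX/= memNset// => Bw; rewrite mem_set in wB.
rewrite integral_kcomp//; apply: eq_integral => w _.
rewrite [LHS]integral_kcomp//; apply: eq_integral => u _.
by rewrite integral_dirac// diracT mul1e.
Qed.

Lemma integral_preimage_indic (Y : T -> V) (B : set V) (g : T -> \bar R) :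
  \int[P]_(w in Y @^-1` B) g w = \int[P]_w (g w * (\1_B (Y w))%:E).
Proof. by rewrite integral_mkcond epatch_indic. Qed.

End conditional_distribution.

Section conditional_distribution_calculus.
Context dT dU dV dW dV' (T : measurableType dT) (U : measurableType dU)
  (V : measurableType dV) (V' : measurableType dV') (W : measurableType dW)
  (R : realType) (P : probability T R).
Local Open Scope ereal_scope.

(** Tower property: the event on [Y] is a cylinder event on [(Y, Z)], and its indicator does not
    depend on [Z], so it leaves the inner integral over [p]. *)
Lemma cond_dist_pkcomp (X : T -> W) (Y : T -> V) (Z : T -> U)
    (p : R.-pker V ~> U) (q : R.-pker (V * U) ~> W) :
  measurable_fun setT Y -> measurable_fun setT Z ->
  is_cond_dist P Z Y p -> is_cond_dist P X (fun w => (Y w, Z w)) q ->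
  is_cond_dist P X Y (pkcomp p q).
Proof.
move=> mY mZ ZY XYZ A B mA mB.
have -> : Y @^-1` B = (fun w => (Y w, Z w)) @^-1` (B `*` setT).
  by apply/seteqP; split => w //= [].
rewrite XYZ//; last exact: measurableX.
rewrite !integral_preimage_indic.
have indicX w : \1_(B `*` [set: U]) (Y w, Z w) = \1_B (Y w) :> R.
  by rewrite !indicE in_setX/= in_setT andbT.
under eq_integral do rewrite indicX.
under [RHS]eq_integral do rewrite indicX.
have mq : measurable_fun setT (q ^~ A) by exact: measurable_kernel.
have mB' : measurable_fun [set: V * U] (fun z => (\1_B z.1)%:E : \bar R).
  by apply/measurable_EFinP; exact: measurableT_comp.
rewrite (@cond_dist_integral _ _ _ _ _ _ _ _ Z Y p
  (fun z => q z A * (\1_B z.1)%:E))//=.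
- apply: eq_integral => w _.
  rewrite ge0_integralZr//; first exact: measurableT_comp mq _.
- exact: emeasurable_funM.
Qed.

(** Events on [h \o Y] are events on [Y]. This serves both to discard a conditioning variable that
    the kernel ignores and to rewrite the conditioning in other variables. *)
Lemma cond_dist_image(X : T -> W) (Y : T -> V)
    (h : V -> V') (kappa : R.-pker V ~> W) (kappa' : R.-pker V' ~> W) :
  measurable_fun setT h -> (forall w, kappa (Y w) = kappa' (h (Y w))) ->
  is_cond_dist P X Y kappa -> is_cond_dist P X (h \o Y) kappa'.
Proof.
move=> mh kk' XY A B mA mB; rewrite comp_preimage XY//.
  by under eq_integral do rewrite kk'.
by rewrite -[X in measurable X]setTI; exact: mh.
Qed.

End conditional_distribution_calculus.

(** * Enlarging the conditioning by an independent variable *)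

Section conditional_independence.
Context dT dU dV dW (T : measurableType dT) (U : measurableType dU)
  (V : measurableType dV) (W : measurableType dW) (R : realType)
  (P : probability T R).
Local Open Scope ereal_scope.

(* Independence makes the constant kernel [law N] a conditional distribution of
   [N] given [(Z, X)], so both sides reduce to
   [E (kappa Z A * law N {n | C (Z, n)})]. *)
Lemma cond_dist_indep (X : T -> W) (Z : T -> V) (N : {RV P >-> U})
    (kappa : R.-pker V ~> W) :
  measurable_fun setT X -> measurable_fun setT Z ->
  (forall E B, measurable E -> measurable B ->
    P (N @^-1` B `&` (fun w => (Z w, X w)) @^-1` E) =
    P (N @^-1` B) * P ((fun w => (Z w, X w)) @^-1` E)) ->
  is_cond_dist P X Z kappa ->
  is_cond_dist P X (fun w => (Z w, N w)) (kpullback kappa measurable_fst).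
Proof.
move=> mX mZ indep XZ A C mA mC.
pose lawN d' (S : measurableType d') : R.-pker S ~> U :=
  kprobability (@measurable_cst _ _ S _ setT
    (distribution P N : pprobability U R)).
have NZX : is_cond_dist P N (fun w => (Z w, X w)) (@lawN _ (V * W)%type).
  move=> B E mB mE; rewrite indep// integral_cst//.
  by rewrite -[X in measurable X]setTI; exact: measurable_fun_pair.
have NZ : is_cond_dist P N Z (@lawN _ V).
  exact: (cond_dist_image (h := fst) (kappa' := @lawN _ V)
    measurable_fst _ NZX).
have mCe : measurable_fun setT (fun z : V * U => (\1_C z)%:E : \bar R).
  exact/measurable_EFinP.
have mAe : measurable_fun setT (fun x : W => (\1_A x)%:E : \bar R).
  exact/measurable_EFinP.
pose g z := \int[lawN _ V z]_n (\1_C (z, n))%:E.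
have g0 z : 0 <= g z by apply: integral_ge0 => n _; rewrite lee_fin.
have mg : measurable_fun setT g.
  exact: (measurable_fun_integral_sfinite_kernel
    (fun z => (\1_C z)%:E) (@lawN _ V)).
have mkA : measurable_fun setT (kappa ^~ A) by exact: measurable_kernel.
transitivity (\int[P]_w (kappa (Z w) A * g (Z w))).
  transitivity (\int[P]_w ((\1_A (X w))%:E * (\1_C (Z w, N w))%:E)).
    have mXA : measurable (X @^-1` A).
      by rewrite -[X in measurable X]setTI; exact: mX.
    have mZNC : measurable ((fun w => (Z w, N w)) @^-1` C).
      by rewrite -[X in measurable X]setTI; exact: measurable_fun_pair.
    rewrite -[X in P X]setIT -integral_indic//; last exact: measurableI.
    by apply: eq_integral => w _; rewrite indicI.
  (* [N] is averaged out first, given [(Z, X)], which leaves [g (Z w)]; then [X] is averaged out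
     given [Z], which produces [kappa (Z w) A]. *)
  rewrite (@cond_dist_integral _ _ _ _ _ _ _ _ N (fun w => (Z w, X w)) _
    (fun z => (\1_A z.1.2)%:E * (\1_C (z.1.1, z.2))%:E)
    _ _ NZX)//=; last 2 first.
  - exact: measurable_fun_pair.
  - apply: emeasurable_funM.
      by apply: measurableT_comp mAe _; exact: measurableT_comp.
    apply: measurableT_comp mCe _; apply: measurable_fun_pair => //.
    exact: measurableT_comp.
  transitivity (\int[P]_w ((\1_A (X w))%:E * g (Z w))).
    apply: eq_integral => w _; rewrite ge0_integralZl//.
    exact: measurableT_comp mCe _.
  rewrite (@cond_dist_integral _ _ _ _ _ _ _ _ X Z _
    (fun z => (\1_A z.2)%:E * g z.1) _ _ XZ)//=; last 2 first.
  - by move=> z; rewrite mule_ge0// lee_fin.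
  - apply: emeasurable_funM; first exact: measurableT_comp mAe _.
    exact: measurableT_comp mg _.
  apply: eq_integral => w _.
  by rewrite ge0_integralZr// integral_indic// setIT.
rewrite integral_preimage_indic.
rewrite (@cond_dist_integral _ _ _ _ _ _ _ _ N Z _
    (fun z => kappa z.1 A * (\1_C z)%:E) _ _ NZ)//=; last first.
  by apply: emeasurable_funM => //; exact: measurableT_comp mkA _.
apply: eq_integral => w _; rewrite ge0_integralZl//.
exact: measurableT_comp mCe _.
Qed.

End conditional_independence.

(** * Independence of sigma-algebras generated by disjoint subfamilies *)

Section mutual_independence.
Context dT (T : measurableType dT) (R : realType) (P : probability T R).
Local Open Scope ereal_scope.

(** For fixed [B], the restriction of [P] to [B] and the multiple of [P] by [P B] are finite
    measures that agree on the pi-system [G]. *)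
Lemma g_sigma_algebra_indep (G : set (set T)) (B : set T) :
  setI_closed G -> G setT -> G `<=` measurable -> measurable B ->
  (forall A, G A -> P (A `&` B) = P A * P B) ->
  forall A, <<s G >> A -> P (A `&` B) = P A * P B.
Proof.
move=> GI GT mG mB indep A sGA.
have PB0 : (0 <= fine (P B))%R by exact: fine_ge0.
have PB : P B = (NngNum PB0)%:num%:E by rewrite /= fineK// fin_num_measure.
rewrite [RHS]muleC PB -[RHS]/(mscale (NngNum PB0) P A) -[LHS]/(mrestr P mB A).
apply: (@g_sigma_algebra_measure_unique _ _ _ G _ (fun=> setT) _ _ (mrestr P mB)
  (mscale (NngNum PB0) P)) => //.
- by rewrite bigcup_const.
- by move=> A' GA'; rewrite -[LHS]/(P (A' `&` B)) indep// muleC [X in X * _]PB.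
- move=> _; rewrite -[ltLHS]/(P (setT `&` B)) setTI.
  by rewrite (le_lt_trans (probability_le1 _ mB))// ltry.
Qed.

Context (I : finType) (F : I -> set (set T)).
Hypotheses (FT : forall i, F i setT) (FI : forall i, setI_closed (F i))
  (Fm : forall i, F i `<=` measurable).

(** A pi-system containing each [F i] with [i] in [J]; the plain union of the [F i] need not be
    closed under intersection. *)
Definition finite_setI (J : {set I}) : set (set T) :=
  [set A | exists2 E : I -> set T,
     (forall i, i \in J -> F i (E i)) & A = \big[setI/setT]_(i in J) E i].

Let finite_setI_closed J : setI_closed (finite_setI J).
Proof.
move=> _ _ [E FE ->] [E' FE' ->].
exists (fun i => E i `&` E' i); last by rewrite big_split.
by move=> i iJ; apply: FI; [exact: FE|exact: FE'].
Qed.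

Let finite_setIT J : finite_setI J setT.
Proof. by exists (fun=> setT) => //; rewrite big1. Qed.

Let finite_setI_measurable J : finite_setI J `<=` measurable.
Proof.
move=> _ [E FE ->]; apply: bigsetI_measurable => i iJ; exact: Fm (FE _ iJ).
Qed.

Let sub_finite_setI (J : {set I}) :
  \bigcup_(i in [set` J]) F i `<=` finite_setI J.
Proof.
move=> A [i /= iJ FA]; exists (fun j => if j == i then A else setT).
  by move=> j _; case: eqP => [->|_].
rewrite (bigD1 i)//= eqxx big1 ?setIT// => j /andP[_ /negPf ->//].
Qed.

(** The product formula holds on the two pi-systems [finite_setI], and is then extended to the
    generated sigma-algebras one side at a time. *)
Lemma mutually_independent_disjoint (J1 J2 : {set I}) :
  mutually_independent P F -> {in J1, forall i, i \notin J2} ->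
  forall A B, <<s \bigcup_(i in [set` J1]) F i >> A ->
    <<s \bigcup_(i in [set` J2]) F i >> B -> P (A `&` B) = P A * P B.
Proof.
move=> indep J12 A B sA sB.
have dJ : fintype.disjoint (mem J1) (mem J2).
  by rewrite disjoint_subset; apply/fintype.subsetP => i /J12; rewrite inE.
have base : forall A B, finite_setI J1 A -> finite_setI J2 B ->
    P (A `&` B) = P A * P B.
  move=> _ _ [E FE ->] [E' FE' ->].
  (* Disjointness lets both families be spliced into one, to which mutual independence applies over
     [J1], over [J2] and over their union. *)
  pose E0 i := if i \in J1 then E i else E' i.
  have FE0 (J : {set I}) : J \subset finset.setU J1 J2 ->
      forall i, i \in J -> F i (E0 i).
    move=> /fintype.subsetP sJ i /sJ; rewrite inE /E0.
    by case: ifPn => [iJ1 _|_ /= iJ2]; [exact: FE|exact: FE'].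
  have eE : \big[setI/setT]_(i in J1) E i = \big[setI/setT]_(i in J1) E0 i.
    by apply: eq_bigr => i iJ1; rewrite /E0 iJ1.
  have eE' : \big[setI/setT]_(i in J2) E' i = \big[setI/setT]_(i in J2) E0 i.
    apply: eq_bigr => i iJ2; rewrite /E0 ifN//.
    by apply/negP => /J12; rewrite iJ2.
  rewrite eE eE' (indep J1)//; last by apply: FE0; exact: finset.subsetUl.
  rewrite (indep J2)//; last by apply: FE0; exact: finset.subsetUr.
  transitivity (P (\big[setI/setT]_(i in finset.setU J1 J2) E0 i)).
    by congr (P _); rewrite -bigU//=; apply: eq_bigl => i; rewrite !inE.
  rewrite (indep (finset.setU J1 J2))//; last exact: FE0.
  by rewrite -bigU//=; apply: eq_bigl => i; rewrite !inE.
have sA' := sub_sigma_algebra2 (@sub_finite_setI J1) sA.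
have sB' := sub_sigma_algebra2 (@sub_finite_setI J2) sB.
have mB : measurable B.
  exact: smallest_sub (sigma_algebra_measurable T)
    (@finite_setI_measurable J2) _ sB'.
apply: (@g_sigma_algebra_indep (finite_setI J1)) => // A1 FA1.
rewrite setIC muleC; apply: (@g_sigma_algebra_indep (finite_setI J2)) => //.
  exact: finite_setI_measurable FA1.
by move=> B1 FB1; rewrite setIC muleC base.
Qed.

End mutual_independence.

(** * Measurability of matrix-valued maps *)

Section measurable_matrix_theory.
Context d (T : measurableType d) (R : realType).

Lemma measurable_fun_matrixP m n (f : T -> 'M[R]_(m, n)) :
  measurable_fun setT f <->
  forall i j, measurable_fun setT (fun w => f w i j).
Proof.
split=> [mf i j|mf].
  apply: (@measurableT_comp _ _ _ _ _ _ (fun M : 'M[R]_(m, n) => M i j)) => //.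
  move=> _ A mA; apply: sub_sigma_algebra.
  by exists (i, j) => //; exists A.
apply: measurability => //.
move=> _ [_ [[i j] _ [A mA <-]] <-]; rewrite !setTI.
by have := mf i j measurableT A mA; rewrite setTI.
Qed.

Lemma measurable_mulmx m n p (M : 'M[R]_(m, n)) (f : T -> 'M[R]_(n, p)) :
  measurable_fun setT f -> measurable_fun setT (fun w => M *m f w).
Proof.
move=> /measurable_fun_matrixP mf; apply/measurable_fun_matrixP => i j.
under eq_fun do rewrite mxE.
by apply: measurable_sum => k; apply: measurable_funM.
Qed.

Lemma measurable_addmx m n (f g : T -> 'M[R]_(m, n)) :
  measurable_fun setT f -> measurable_fun setT g ->
  measurable_fun setT (fun w => f w + g w).
Proof.
move=> /measurable_fun_matrixP mf /measurable_fun_matrixP mg.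
apply/measurable_fun_matrixP => i j.
by under eq_fun do rewrite mxE; exact: measurable_funD.
Qed.

End measurable_matrix_theory.

(** * Degenerate Gaussians and point masses *)

(** Each coordinate has variance 0, hence equals that of [m] almost surely; a finite union of null
    sets then covers everything but [m]. *)
Lemma gaussian0_dirac (R : realType) (n : nat)
    (mu : {measure set 'cV[R]_n -> \bar R}) (m : 'cV[R]_n) :
  mu setT = 1%E -> is_gaussian mu m 0 ->
  forall A, measurable A -> mu A = dirac m A.
Proof.
move=> mu1 mu0 A mA.
have muC B : measurable B -> mu (~` B) = (1 - mu B)%E.
  move=> mB; rewrite -setTD measureD//; last by rewrite [ltLHS]mu1 ltry.
  by rewrite setTI [X in (X - _)%E]mu1.
have mcoord i : measurable [set x : 'cV[R]_n | x i 0 = m i 0].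
  have /measurable_fun_matrixP/(_ i 0) := @measurable_id _ 'cV[R]_n setT.
  move=> /(_ measurableT [set m i 0]); rewrite setTI; exact.
have coord i : mu (~` [set x : 'cV[R]_n | x i 0 = m i 0]) = 0%E.
  (* Testing against the basis vector [delta_mx i 0] isolates coordinate [i]. *)
  have := mu0 (delta_mx i 0) [set m i 0] (measurable_set1 _).
  rewrite /normal1 mulmx0 mul0mx mxE eqxx.
  have coordE (x : 'cV[R]_n) : ((delta_mx i 0)^T *m x) 0 0 = x i 0.
    rewrite mxE (bigD1 i)//= !mxE !eqxx mul1r big1 ?addr0// => j ji.
    by rewrite !mxE (negbTE ji) mul0r.
  under eq_set do rewrite coordE.
  rewrite coordE diracE mem_set// => mu1B.
  by rewrite muC// mu1B subee.
pose N := \big[setU/set0]_(i <- enum 'I_n)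
  ~` [set x : 'cV[R]_n | x i 0 = m i 0].
have mN : measurable N by apply: bigsetU_measurable => i _; exact: measurableC.
have N0 : mu N = 0%E.
  rewrite /N; elim: (enum _) => [|i s IHs]; first by rewrite big_nil measure0.
  rewrite big_cons setUC measureU0 ?IHs//; first last.
  - exact: measurableC.
  - by apply: bigsetU_measurable => j _; exact: measurableC.
have subN : ~` [set m] `<=` N.
  move=> x xm; rewrite /N -bigcup_seq; apply: contra_notP xm => xN.
  apply/matrixP => i j; rewrite ord1; apply: contrapT => xi; apply: xN.
  by exists i => //=; rewrite mem_enum.
(* Whichever of [A] and its complement misses [m] lies in the null set [N]. *)
rewrite diracE; have [Am|Am] := boolP (m \in A).
  have mCA : measurable (~` A) by exact: measurableC.
  rewrite -[A]setCK muC// (subset_measure0 mCA mN _ N0) ?sube0//.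
  apply: subset_trans subN => x /= Ax xm.
  by apply: Ax; rewrite xm; exact: set_mem.
apply: (subset_measure0 mA mN _ N0).
by apply: subset_trans subN => x /= Ax xm; move: Am; rewrite -xm mem_set.
Qed.

(** As a function of [w], [dirac (X w) A] is the indicator of the event that [X] lies in [A]. This
    is the base case of the recursion, where [x 0] is itself a conditioning variable. *)
Lemma cond_dist_dirac dT dU dV (T : measurableType dT) (U : measurableType dU)
    (V : measurableType dV) (R : realType) (P : probability T R)
    (X : T -> U) (Y : T -> V) (kappa : R.-pker V ~> U) :
  measurable_fun setT X -> measurable_fun setT Y ->
  (forall w A, measurable A -> kappa (Y w) A = dirac (X w) A) ->
  is_cond_dist P X Y kappa.
Proof.
move=> mX mY kX A B mA mB; under eq_integral do rewrite kX// diracE.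
rewrite -[RHS]/(\int[P]_(w in Y @^-1` B) (\1_(X @^-1` A) w)%:E)%E.
rewrite integral_indic//.
  by rewrite -[X in measurable X]setTI; exact: mY.
by rewrite -[X in measurable X]setTI; exact: mX.
Qed.

(** Retyping the source as [g_sigma_algebraType G] expresses that [X] depends only on the
    information in [G]. *)
Lemma measurable_fun_g_sigma_of dT dU (T : measurableType dT)
    (U : measurableType dU) (X : T -> U) (G : set (set T)) :
  sigma_of X `<=` G ->
  measurable_fun setT (X : g_sigma_algebraType G -> U).
Proof.
by move=> XG _ A mA; apply: sub_sigma_algebra; apply: XG; exists A.
Qed.

(** * Extending observation tuples *)

Section append_last.
Context (V : Type) (k : nat).

(** The [insub] form has length [k] for every [k]: at [k = 0] both tuples are empty and [v] is
    discarded, matching the convention for [y_{1:-1}]. *)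
Definition append_last (t : k.-1.-tuple V) (v : V) : k.-tuple V :=
  [tuple if insub (val i) is Some j then tnth t j else v | i < k].

Lemma drop_last_append (t : k.-1.-tuple V) (v : V) :
  drop_last (append_last t v) = t.
Proof.
apply: eq_from_tnth => i; rewrite !tnth_mktuple.
case: insubP => [j _ ji|]; last by rewrite /= ltn_ord.
by congr tnth; exact: val_inj.
Qed.

Lemma append_last_obs (T : Type) (y : nat -> T -> V) (v : V) (w : T) :
  ((0 < k)%N -> v = y k w) -> append_last (obs y k.-1 w) v = obs y k w.
Proof.
move=> vy; apply: eq_from_tnth => i; rewrite !tnth_mktuple.
case: insubP => [j _ ji|]; first by rewrite tnth_mktuple ji.
(* [insub] fails only at the last index [i = k - 1], whose entry in [obs] is [y i.+1], that is
   [y k]. *)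
rewrite -leqNgt => ki; have k0 : (0 < k)%N by exact: leq_ltn_trans (ltn_ord i).
rewrite (vy k0); congr (y _ _); apply/eqP; rewrite eqn_leq ltn_ord andbT.
by rewrite (leq_trans (leqSpred k))// ltnS; exact: ki.
Qed.

End append_last.

Lemma measurable_append_last d d' (S : measurableType d) (V : measurableType d')
    (k : nat) (f : S -> k.-1.-tuple V) (g : S -> V) :
  measurable_fun setT f -> measurable_fun setT g ->
  measurable_fun setT (fun s => append_last (f s) (g s)).
Proof.
move=> mf mg; apply/measurable_fun_tnthP => i.
rewrite (_ : _ \o _ = fun s =>
    if insub (val i) is Some j then tnth (f s) j else g s).
  case: insub => [j|//]; exact: (measurable_fun_tnthP _).1 mf j.
by apply/funext => s /=; rewrite tnth_mktuple.
Qed.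

Lemma measurable_obs d d' (T : measurableType d) (V : measurableType d')
    (y : nat -> T -> V) (k : nat) :
  (forall i, measurable_fun setT (y i)) -> measurable_fun setT (obs y k).
Proof.
move=> my; apply/measurable_fun_tnthP => i.
rewrite (_ : _ \o _ = y i.+1)//.
by apply/funext => w /=; rewrite tnth_mktuple.
Qed.

(** * Past and future noises in the state-space model *)

Section state_space_model.
Context (R : realType) (dT : measure_display) (T : measurableType dT)
  (P : probability T R) (d D K : nat).
Context (theta : {RV P >-> 'cV[R]_D}) (b : nat -> {RV P >-> 'cV[R]_D})
  (r : nat -> {RV P >-> 'cV[R]_d}).
Context (x : nat -> {RV P >-> 'cV[R]_D}) (y : nat -> {RV P >-> 'cV[R]_d}).
Context (A : nat -> 'M[R]_D) (H : nat -> 'M[R]_(d, D)).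
Context (noise_indep :
    mutually_independent P (@noise_sigma dT T R d D K theta b r))
  (x_init : forall w, x 0%N w = theta w)
  (x_step : forall k, (1 <= k <= K)%N ->
     forall w, x k w = A k *m x k.-1 w + b k w)
  (y_obs : forall k, (1 <= k <= K)%N ->
     forall w, y k w = H k *m x k w + r k w).

Local Notation noise := (@noise_sigma dT T R d D K theta b r).

(* The indices of the noises on which [(x_{0:k}, y_{1:k-1})] depends; [inl j]
   stands for [b_{j+1}] and [inr j] for [r_{j+1}]. *)
Definition past (k : nat) : {set option ('I_K + 'I_K)} :=
  [set i : option ('I_K + 'I_K) | match i with
           | None => true
           | Some (inl j) => (j < k)%N
           | Some (inr j) => (j.+1 < k)%N
           end]%SET.

Definition generated_by (J : {set option ('I_K + 'I_K)}) : set (set T) :=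
  \bigcup_(i in [set` J]) noise i.

Lemma noise_generated_by (J : {set option ('I_K + 'I_K)}) i :
  i \in J -> noise i `<=` generated_by J.
Proof. by move=> iJ E; exists i. Qed.

(** By induction on [j], [x j] is a measurable function of [theta] and [b 1], ..., [b j], whose
    indices all lie in [past k]. *)
Lemma state_past k j : (j <= k <= K)%N ->
  measurable_fun setT (x j : g_sigma_algebraType (generated_by (past k)) -> _).
Proof.
move=> /andP[+ kK]; elim: j => [_|j IHj jk].
  have -> : (x 0%N : T -> _) = theta by exact/funext.
  apply: measurable_fun_g_sigma_of.
  by apply: (@noise_generated_by _ None); rewrite inE.
have jK : (j < K)%N by exact: leq_trans kK.
have -> : (x j.+1 : T -> _) = fun w => A j.+1 *m x j w + b j.+1 w.
  by apply/funext => w; rewrite x_step.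
apply: measurable_addmx; first by apply: measurable_mulmx; exact: IHj (ltnW jk).
apply: measurable_fun_g_sigma_of.
by apply: (@noise_generated_by _ (Some (inl (Ordinal jK)))); rewrite inE.
Qed.

Lemma obs_past k : (k <= K)%N ->
  measurable_fun setT
    (obs y k.-1 : g_sigma_algebraType (generated_by (past k)) -> _).
Proof.
move=> kK; apply/measurable_fun_tnthP => i.
have ik : (i.+1 < k)%N by rewrite -ltn_predRL.
have iK : (i < K)%N by rewrite (leq_trans _ kK)// ltnW.
have -> : @tnth _ _ ^~ i \o obs y k.-1 = fun w => H i.+1 *m x i.+1 w + r i.+1 w.
  by apply/funext => w /=; rewrite tnth_mktuple y_obs.
apply: measurable_addmx.
  by apply: measurable_mulmx; apply: state_past; rewrite (ltnW ik).
apply: measurable_fun_g_sigma_of.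
by apply: (@noise_generated_by _ (Some (inr (Ordinal iK)))); rewrite inE.
Qed.

Lemma past_future_indep k E F :
  <<s generated_by (past k) >> E ->
  <<s generated_by (finset.setC (past k)) >> F ->
  (P (E `&` F) = P E * P F)%E.
Proof.
apply: mutually_independent_disjoint => //.
- by case=> [[j|j]|]; exists setT => //; rewrite setIT.
- by case=> [[j|j]|] _ _ [E1 mE1 <-] [E2 mE2 <-]; exists (E1 `&` E2);
    rewrite ?setTI//; exact: measurableI.
- by case=> [[j|j]|] _ [E1 mE1 <-]; exact: measurable_funP.
- by move=> i; rewrite finset.in_setC => ->.
Qed.

(** The triple [x k], [obs y k.-1], [x 0] is a function of the past noises, and [N] of the
    complementary ones, so [N] is independent of the whole triple. *)
Lemma cond_dist_future_noise k dU (U : measurableType dU) (N : {RV P >-> U})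
    (kappa : R.-pker ('cV[R]_D * k.-1.-tuple 'cV[R]_d) ~> 'cV[R]_D) :
  (k <= K)%N ->
  measurable_fun setT
    (N : g_sigma_algebraType (generated_by (finset.setC (past k))) -> U) ->
  is_cond_dist P (x 0%N) (fun w => (x k w, obs y k.-1 w)) kappa ->
  is_cond_dist P (x 0%N) (fun w => ((x k w, obs y k.-1 w), N w))
    (kpullback kappa measurable_fst).
Proof.
move=> kK mN; apply: cond_dist_indep => //.
  by apply: measurable_fun_pair => //; exact: measurable_obs.
move=> E F mE mF; rewrite setIC muleC; apply: (@past_future_indep k).
  have mxx : measurable_fun setT
      ((fun w => ((x k w, obs y k.-1 w), x 0%N w)) :
        g_sigma_algebraType (generated_by (past k)) -> _).
    apply: measurable_fun_pair; last exact: state_past.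
    apply: measurable_fun_pair; last exact: obs_past.
    by apply: state_past; rewrite leqnn.
  by have := mxx measurableT E mE; rewrite setTI.
by have := mN measurableT F mF; rewrite setTI.
Qed.

(** [b k.+1] has index [inl k], the first one excluded by the bound [j < k] in [past k]. *)
Lemma state_noise_future k (kK : (k < K)%N) :
  measurable_fun setT
    (b k.+1 : g_sigma_algebraType (generated_by (finset.setC (past k))) -> _).
Proof.
apply: measurable_fun_g_sigma_of.
by apply: (@noise_generated_by _ (Some (inl (Ordinal kK)))); rewrite !inE ltnn.
Qed.

(** [r k] has index [inr k.-1], the first one excluded by [j.+1 < k]: the conditioning at time [k]
    stops at [y k.-1]. *)
Lemma obs_noise_future k (kK : (0 < k <= K)%N) :
  measurable_fun setT
    (r k : g_sigma_algebraType (generated_by (finset.setC (past k))) -> _).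
Proof.
case: k kK => // k kK; apply: measurable_fun_g_sigma_of.
by apply: (@noise_generated_by _ (Some (inr (Ordinal kK)))); rewrite !inE ltnn.
Qed.

(** * Correctness of the smoothing recursion *)

Context (q0 : R.-pker 'cV[R]_D ~> 'cV[R]_D)
  (q0_init : forall x0 : 'cV[R]_D, is_gaussian (q0 x0) (1%:M *m x0 + 0) 0)
  (p : forall k, R.-pker ('cV[R]_D * k.-1.-tuple 'cV[R]_d) ~> 'cV[R]_D)
  (p_cond : forall k, (1 <= k <= K)%N ->
     is_cond_dist P (x k.-1) (fun w => (x k w, obs y k.-1 w)) (p k)).

(** Induction from [k = 0], where the observation tuple is empty and [q0] is a point mass. In the
    step, [cond_dist_pkcomp] integrates out [x k], leaving the claim that the previous kernel still
    describes [x 0] given [x k], [x k.+1] and [obs y k]. *)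
Lemma smoother_cond_dist k : (k <= K)%N ->
  is_cond_dist P (x 0%N) (fun w => (x k w, obs y k.-1 w)) (smoother q0 p k).
Proof.
elim: k => [_|k IHk kK].
  apply: cond_dist_dirac => //.
    by apply: measurable_fun_pair => //; exact: measurable_obs.
  move=> w B mB.
  have := @gaussian0_dirac R D (q0 (x 0%N w)) _ (prob_kernel _)
    (q0_init _) B mB.
  by rewrite mul1mx addr0.
have mobs j : measurable_fun setT (obs y j) by exact: measurable_obs.
apply: cond_dist_pkcomp; last 2 first.
- exact: p_cond.
- (* there is no observation at time 0, hence no noise r_0 in the model *)
  pose rk w := if k is 0 then 0 else r k w.
  have mrk : measurable_fun setT rk by rewrite /rk; case: (k).
  have mN : measurable_fun setT (fun w => (rk w, b k.+1 w)).
    exact: measurable_fun_pair.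
  pose N : {RV P >-> ('cV[R]_d * 'cV[R]_D)%type} := mfun_Sub (mem_set mN).
  (* [h] rebuilds the new conditioning variables from the old ones and the fresh noises by the model
     equations, keeping [x k] as the variable to be integrated out. *)
  pose h (z : ('cV[R]_D * k.-1.-tuple 'cV[R]_d) * ('cV[R]_d * 'cV[R]_D)) :=
    ((A k.+1 *m z.1.1 + z.2.2, append_last z.1.2 (H k *m z.1.1 + z.2.1)),
     z.1.1).
  have mh : measurable_fun setT h.
    have mz11 : measurable_fun setT (fun z : ('cV[R]_D * k.-1.-tuple 'cV[R]_d)
        * ('cV[R]_d * 'cV[R]_D) => z.1.1) by exact: measurableT_comp.
    apply: measurable_fun_pair => //; apply: measurable_fun_pair.
      apply: measurable_addmx; first exact: measurable_mulmx.
      exact: measurableT_comp.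
    apply: measurable_append_last; first exact: measurableT_comp.
    apply: measurable_addmx; first exact: measurable_mulmx.
    exact: measurableT_comp.
  have hE : (fun w => ((x k.+1 w, obs y k w), x k w)) =
      h \o (fun w => ((x k w, obs y k.-1 w), N w)).
    apply/funext => w; rewrite /h /= x_step//; congr (_, _, _).
    apply/esym/append_last_obs => k0.
    by rewrite y_obs ?k0 1?ltnW// /rk; case: (k) k0.
  rewrite hE; apply: (cond_dist_image mh); last first.
    apply: cond_dist_future_noise (IHk (ltnW kK)) => //; first exact: ltnW.
    apply: measurable_fun_pair; last exact: state_noise_future.
    rewrite /rk; case: (k) kK => [|j] jK; first exact: measurable_cst.
    by apply: obs_noise_future; rewrite /= ltnW.
  (* The pulled-back kernel reads [x k] and drops the last observation, so it receives exactly the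
     old arguments. *)
  move=> w; rewrite -[RHS]/(smoother q0 p k (x k w, drop_last (append_last
    (obs y k.-1 w) (H k *m x k w + rk w)))).
  by rewrite drop_last_append.
- by apply: measurable_fun_pair => //; exact: mobs.
- by [].
Qed.

(** No transition follows time [K], so [r K] is the only fresh noise: [obs y K] is a function of
    [x K], [obs y K.-1] and [r K], and the filtering kernel integrates out [x K]. *)
Lemma smoother_output_cond_dist
    (pf : R.-pker (K.-tuple 'cV[R]_d) ~> 'cV[R]_D) :
  (0 < K)%N -> is_cond_dist P (x K) (obs y K) pf ->
  is_cond_dist P (x 0%N) (obs y K) (smoother_output (smoother q0 p K) pf).
Proof.
move=> K0 pf_cond.
apply: (cond_dist_pkcomp _ _ pf_cond) => //; first exact: measurable_obs.
pose h (z : ('cV[R]_D * K.-1.-tuple 'cV[R]_d) * 'cV[R]_d) :=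
  (append_last z.1.2 (H K *m z.1.1 + z.2), z.1.1).
have mh : measurable_fun setT h.
  apply: measurable_fun_pair; last exact: measurableT_comp.
  apply: measurable_append_last; first exact: measurableT_comp.
  apply: measurable_addmx => //; apply: measurable_mulmx.
  exact: measurableT_comp.
have hE : (fun w => (obs y K w, x K w)) =
    h \o (fun w => ((x K w, obs y K.-1 w), r K w)).
  apply/funext => w; rewrite /h /= append_last_obs// => _.
  by rewrite y_obs// K0 leqnn.
rewrite hE; apply: (cond_dist_image mh); last first.
  apply: cond_dist_future_noise; [by []| |exact: smoother_cond_dist].
  by apply: obs_noise_future; rewrite K0 leqnn.
move=> w; rewrite -[RHS]/(smoother q0 p K (x K w, drop_last (append_last
  (obs y K.-1 w) (H K *m x K w + r K w)))).
by rewrite drop_last_append.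
Qed.

End state_space_model.

Theorem mainTheorem1 (R : realType) (dT : measure_display)
  (T : measurableType dT) (P : probability T R)
  (d D K : nat) (d_ge1 : (1 <= d)%N) (D_ge1 : (1 <= D)%N) (K_ge1 : (1 <= K)%N)
  (* model parameters *)
  (A : nat -> 'M[R]_D) (H : nat -> 'M[R]_(d, D))
  (m00 : 'cV[R]_D) (C00 : 'M[R]_D) (B : nat -> 'M[R]_D) (Rn : nat -> 'M[R]_d)
  (C00_cov : is_covariance C00)
  (B_cov : forall k, (1 <= k <= K)%N -> is_covariance (B k))
  (Rn_cov : forall k, (1 <= k <= K)%N -> is_covariance (Rn k))
  (* noises *)
  (theta : {RV P >-> 'cV[R]_D}) (b : nat -> {RV P >-> 'cV[R]_D})
  (r : nat -> {RV P >-> 'cV[R]_d})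
  (theta_law : is_gaussian (distribution P theta) m00 C00)
  (b_law : forall k, (1 <= k <= K)%N -> is_gaussian (distribution P (b k)) 0 (B k))
  (r_law : forall k, (1 <= k <= K)%N -> is_gaussian (distribution P (r k)) 0 (Rn k))
  (noise_indep : mutually_independent P (@noise_sigma dT T R d D K theta b r))
  (* states and observations *)
  (x : nat -> {RV P >-> 'cV[R]_D}) (y : nat -> {RV P >-> 'cV[R]_d})
  (x_init : forall w, x 0%N w = theta w)
  (x_step : forall k, (1 <= k <= K)%N ->
     forall w, x k w = A k *m x k.-1 w + b k w)
  (y_obs : forall k, (1 <= k <= K)%N ->
     forall w, y k w = H k *m x k w + r k w)
  (* step 1: q_0( . | x_0) = N(I x_0 + 0, 0) *)
  (q0 : R.-pker 'cV[R]_D ~> 'cV[R]_D)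
  (q0_init : forall x0 : 'cV[R]_D, is_gaussian (q0 x0) (1%:M *m x0 + 0) 0)
  (* step 2: p k is p(x_{k-1} | x_k, y_{1:k-1}) *)
  (p : forall k, R.-pker ('cV[R]_D * k.-1.-tuple 'cV[R]_d) ~> 'cV[R]_D)
  (p_cond : forall k, (1 <= k <= K)%N ->
     is_cond_dist P (x k.-1) (fun w => (x k w, obs y k.-1 w)) (p k))
  (* step 3: pf is p(x_K | y_{1:K}) *)
  (pf : R.-pker (K.-tuple 'cV[R]_d) ~> 'cV[R]_D)
  (pf_cond : is_cond_dist P (x K) (obs y K) pf) :
  (forall k, (1 <= k <= K)%N ->
     is_cond_dist P (x 0%N) (fun w => (x k w, obs y k.-1 w)) (smoother q0 p k))
  /\ is_cond_dist P (x 0%N) (obs y K) (smoother_output (smoother q0 p K) pf).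
Proof.
split=> [k /andP[_ kK]|].
  exact: (smoother_cond_dist noise_indep x_init x_step y_obs q0_init p_cond kK).
exact: (smoother_output_cond_dist noise_indep x_init x_step y_obs q0_init
  p_cond).
Qed.
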